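(* Let $n\ge2$ and consider the path graph on nodes $0,1,\dots,n$ with edges $\{i,i+1\}$, $0\le i\le n-1$, with starting node $X_0=0$. Then $$\mathbb E_{\pi_{neg}}[T_C]<n^2=\mathbb E_{\pi_{rw}}[T_C].$$
   Context: $T_C$ is the smallest $m$ such that $X_0,\dots,X_m$ visit all nodes of the graph. Random walk $\pi_{rw}$: if $X_m=i$, $X_{m+1}$ is a uniformly random neighbour of $i$, independently of the past. Negative feedback $\pi_{neg}$: for an edge from $i$ to $j$, let $N_{ij}^{(m)}$ be the number of times $t<m$ with $X_t=i,X_{t+1}=j$. Let $Smin_i^{(m)}$ be the set of neighbours $j$ of $i$ minimizing $N_{ij}^{(m)}$. If $X_m=i$, then given the past, $X_{m+1}$ is uniformly distributed on $Smin_i^{(m)}$. *)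

(* Defs.v *)
From HB Require Import structures.
From mathcomp Require Import all_boot all_order all_algebra.
From mathcomp Require Import all_classical all_reals all_analysis.

Set Implicit Arguments.
Unset Strict Implicit.
Unset Printing Implicit Defensive.

Import Order.TTheory GRing.Theory Num.Theory.
Local Open Scope classical_set_scope.
Local Open Scope ring_scope.

(* MathComp-Analysis, over an arbitrary realType.  A simple graph on V is a
   (symmetric, irreflexive) e : rel V; a trajectory is x : nat -> V. *)

Definition path_graph (n : nat) : rel 'I_n.+1 :=
  fun i j => (i.+1 == j :> nat) || (j.+1 == i :> nat).

Arguments path_graph n : clear implicits.

Definition neighbours (V : finType) (e : rel V) (i : V) : {set V} :=
  [set j | e i j]%SET.

Definition crossings (V : finType) (x : nat -> V) (m : nat) (i j : V) : nat :=
  #|[set t : 'I_m | (x t == i) && (x t.+1 == j)]%SET|.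

Definition Smin (V : finType) (e : rel V) (x : nat -> V) (m : nat) (i : V) :
    {set V} :=
  [set j in neighbours e i |
    [forall k in neighbours e i, (crossings x m i j <= crossings x m i k)%N]]%SET.

Definition uniform_on (R : realType) (V : finType) (S : {set V}) (y : V) : R :=
  if y \in S then (#|S|%:R)^-1 else 0.

(* A policy sends x and m to the distribution of the (m+1)-st node; both
   policies below read x only at times 0, ..., m. *)
Definition policy (R : realType) (V : finType) := (nat -> V) -> nat -> V -> R.

Definition pi_rw (R : realType) (V : finType) (e : rel V) : policy R V :=
  fun x m => uniform_on R (neighbours e (x m)).

Definition pi_neg (R : realType) (V : finType) (e : rel V) : policy R V :=
  fun x m => uniform_on R (Smin e x m (x m)).

Section Walk.
Context (R : realType) (d : measure_display) (T : measurableType d).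
Context (P : probability T R) (V : finType).

Definition past (X : nat -> T -> V) (x : nat -> V) (m : nat) : set T :=
  [set w | forall t, (t <= m)%N -> X t w = x t].

(* [walk_step] is P(X_{m+1} = y | X_0 = x_0, ..., X_m = x_m) = pi x m y with the
   denominator cleared, so that null pasts carry no constraint. *)
Record follows (pi : policy R V) (x0 : V) (X : nat -> T -> V) : Prop := Follows {
  walk_measurable : forall m v, measurable [set w | X m w = v] ;
  walk_start : P [set w | X 0%N w = x0] = 1%E ;
  walk_step : forall (x : nat -> V) (m : nat) (y : V),
    P (past X x m `&` [set w | X m.+1 w = y])
      = (P (past X x m) * (pi x m y)%:E)%E
}.

Definition covered (X : nat -> T -> V) (w : T) (m : nat) : Prop :=
  forall v, exists2 t, (t <= m)%N & X t w = v.

(* Equals +oo when some node is never visited. *)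
Definition cover_time (X : nat -> T -> V) (w : T) : \bar R :=
  ereal_inf [set (m%:R)%:E | m in covered X w].

(* The library's 'E_P only takes R-valued functions, whereas T_C may be +oo. *)
Definition expected_cover_time (X : nat -> T -> V) : \bar R :=
  (\int[P]_w cover_time X w)%E.

End Walk.

(* Main.v *)
(** A nonnegative function Psi of the past that decreases by at least 1 in
    expectation at every step before the cover time bounds E[T_C] by its initial
    value; if it decreases by exactly 1, is bounded and vanishes at T_C, then
    E[T_C] equals this value.  On the path started at 0, T_C is the hitting time
    of n.  Write p for the current node and s_i for the number of right minus the
    number of left moves made so far from i.
    For the random walk take Psi = n^2 - p^2.
    For negative feedback, s_i is always in {-1, 0, 1} and
    n^2 - p^2 + sum_(i < n) 2 i s_i has drift -1 (its decrease is even
    deterministic).  As s_i is nonnegative for all i < n at time T_C this only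
    gives E[T_C] <= n^2; strictness comes from subtracting from it the conditional
    expectation of the final value of 2 (n-1) s_(n-1), which is
    (n-1) (1 + s_(n-1)) as long as p < n. *)

Require Import Defs.
From mathcomp Require Import all_boot all_order all_algebra.
From mathcomp Require Import all_classical all_reals all_analysis.
From mathcomp Require Import measurable_realfun.
From mathcomp Require Import zify ring lra.

Set Implicit Arguments.
Unset Strict Implicit.
Unset Printing Implicit Defensive.

Import Order.TTheory GRing.Theory Num.Theory.
Local Open Scope classical_set_scope.
Local Open Scope ring_scope.

(** * Pasts, uncovered events and truncated expectations *)

Definition visits_all (V : finType) (x : nat -> V) (m : nat) : Prop :=
  forall v, exists2 t, (t <= m)%N & x t = v.

(** Only the values up to time [m.+1] matter below; the constant tail is arbitrary. *)
Definition extend (V : finType) (x : nat -> V) (m : nat) (y : V) : nat -> V :=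
  fun t => if (t <= m)%N then x t else y.

Section CoverTime.
Context (R : realType) (d : measure_display) (T : measurableType d).
Context (P : probability T R) (V : finType).
Context (pi : policy R V) (x0 : V) (X : nat -> T -> V).
Context (XP : follows P pi x0 X).

Definition uncovered (k : nat) : set T := [set w | ~ covered X w k].

Lemma uncovered_antitone j k : (j <= k)%N -> uncovered k `<=` uncovered j.
Proof.
move=> jk w /= Nk Cj; apply: Nk => v.
by have [t tj <-] := Cj v; exists t => //; apply: leq_trans jk.
Qed.

Lemma measurable_uncovered k : measurable (uncovered k).
Proof.
have -> : uncovered k =
    ~` \bigcap_(v in [set: V]) \bigcup_(t in `I_k.+1) [set w | X t w = v].
  congr (~` _); apply/seteqP; split=> w /= C v => [_|].
    by have [t tk Xt] := C v; exists t.
  by have [t tk Xt] := C v I; exists t.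
apply: measurableC; apply: fin_bigcap_measurable => [|v _].
  exact: finite_finset.
by apply: bigcup_measurable => t _; exact: (walk_measurable XP).
Qed.

Lemma measurable_past x m : measurable (past X x m).
Proof.
have -> : past X x m = \bigcap_(t in `I_m.+1) [set w | X t w = x t].
  by apply/seteqP; split=> w /= h t; apply: h.
by apply: bigcap_measurableType => t _; exact: (walk_measurable XP).
Qed.

Lemma past_extend x m y :
  past X (extend x m y) m.+1 = past X x m `&` [set w | X m.+1 w = y].
Proof.
apply/seteqP; split=> w /=.
  move=> h; split => [t tm|].
    by have := h t (leqW tm); rewrite /extend tm.
  by have := h _ (leqnn m.+1); rewrite /extend ltnn.
move=> [h1 h2] t; rewrite /extend leq_eqVlt ltnS => /orP[/eqP ->|tm].
  by rewrite ltnn.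
by rewrite tm; exact: h1.
Qed.

(** Whether all nodes are visited by time [m] depends only on the trajectory up to [m], so it is
    constant on a past. *)
Lemma past_uncovered x m : past X x m `&` uncovered m =
  if `[< visits_all x m >] then set0 else past X x m.
Proof.
have covE w : past X x m w -> covered X w m <-> visits_all x m.
  move=> h; split=> C v; have [t tm xt] := C v; exists t => //.
    by rewrite -h.
  by rewrite h.
case: asboolP => C; apply/seteqP; split=> w //=.
- by move=> [/covE E]; rewrite /uncovered /= E.
- by case.
- by move=> h; split=> //; rewrite /uncovered /= covE.
Qed.

Local Notation pr A := (fine (P A)).

Lemma fine_probability_ge0 A : 0 <= pr A.
Proof. exact: fine_ge0. Qed.

Lemma fine_probabilityK A : measurable A -> (pr A)%:E = P A.
Proof. by move=> mA; rewrite fineK // fin_num_measure. Qed.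

Lemma le_fine_probability A B :
  measurable A -> measurable B -> A `<=` B -> pr A <= pr B.
Proof.
move=> mA mB AB; rewrite -lee_fin !fine_probabilityK //.
by apply: le_measure; rewrite ?inE.
Qed.

Lemma past_extend_probability x m y :
  pr (past X (extend x m y) m.+1) = pr (past X x m) * pi x m y.
Proof.
rewrite past_extend (walk_step XP) -[in LHS]fine_probabilityK //.
exact: measurable_past.
Qed.

Lemma past_split x m B : measurable B ->
  pr (past X x m `&` B) =
    \sum_(y : V) pr (past X (extend x m y) m.+1 `&` B).
Proof.
move=> mB; have mF y : measurable (past X (extend x m y) m.+1 `&` B).
  by apply: measurableI => //; exact: measurable_past.
have -> : past X x m `&` B =
    \bigcup_(y in [set` enum V]) (past X (extend x m y) m.+1 `&` B).
  apply/seteqP; split=> w /=.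
    move=> [h Bw]; exists (X m.+1 w); first by rewrite /= mem_enum.
    by split=> //; rewrite past_extend; split.
  by move=> [y _ [+ Bw]]; rewrite past_extend => -[].
rewrite measure_fin_bigcup //=.
- rewrite -fsbig_seq ?enum_uniq // big_enum /= -sum_fine //.
  by move=> y _; exact: fin_num_measure.
- apply/trivIsetP=> y z _ _ yz; rewrite !past_extend; apply/seteqP; split=> // w /=.
  by move=> [[[_ h1] _] [[_ h2] _]]; move/eqP: yz; rewrite -h1 -h2.
Qed.

(* The expectation of min(T_C, m + k) - min(T_C, m) on the event past X x m. *)
Definition truncated_remaining x m k : R :=
  \sum_(j < k) pr (past X x m `&` uncovered (m + j)).

(** First-step decomposition: the summand [j = 0] tests whether the past still misses a node, and
    the other summands are split according to the next node. Once everything is visited, all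
    summands vanish because the uncovered events decrease in time. *)
Lemma truncated_remainingS x m k : truncated_remaining x m k.+1 =
  if `[< visits_all x m >] then 0 else pr (past X x m) +
    \sum_y truncated_remaining (extend x m y) m.+1 k.
Proof.
rewrite /truncated_remaining big_ord_recl /= addn0.
have -> : \sum_(i < k) pr (past X x m `&` uncovered (m + bump 0 i)) =
  \sum_y \sum_(j < k) pr (past X (extend x m y) m.+1 `&` uncovered (m.+1 + j)).
  rewrite exchange_big /=; apply: eq_bigr => j _; rewrite addSnnS.
  by rewrite past_split //; exact: measurable_uncovered.
rewrite past_uncovered; case: asboolP => C //.
rewrite measure0 add0r big1 // => y _; rewrite big1 // => j _.
rewrite (_ : _ `&` _ = set0) ?measure0 //; apply/seteqP; split=> // w.
move=> [+ U]; rewrite past_extend => -[h _].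
have : (past X x m `&` uncovered m) w.
  by split=> //; apply: uncovered_antitone U; lia.
by rewrite past_uncovered (asboolT C).
Qed.

Lemma truncated_remaining_null x m k :
  pr (past X x m) = 0 -> truncated_remaining x m k = 0.
Proof.
move=> p0; apply: big1 => j _; apply/eqP; rewrite eq_le fine_probability_ge0 andbT.
rewrite -p0; apply: le_fine_probability; last exact: subIsetl.
- by apply: measurableI; [exact: measurable_past|exact: measurable_uncovered].
- exact: measurable_past.
Qed.

Lemma past_start : P (past X (cst x0) 0) = 1%E.
Proof.
rewrite -(walk_start XP); congr (P _); apply/seteqP; split=> w /=.
  by move=> h; apply: h.
by move=> h t; rewrite leqn0 => /eqP ->.
Qed.

Lemma past_start_uncovered k :
  pr (past X (cst x0) 0 `&` uncovered k) = pr (uncovered k).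
Proof.
congr fine; have mU := measurable_uncovered k.
have mp := measurable_past (cst x0) 0.
have pC : P (~` past X (cst x0) 0) = 0%E.
  by rewrite probability_setC // past_start subee.
have p0 : P (uncovered k `\` past X (cst x0) 0) = 0%E.
  apply: (@subset_measure0 _ _ _ P _ (~` past X (cst x0) 0)).
  - exact: measurableD.
  - exact: measurableC.
  - by move=> w [].
  - exact: pC.
rewrite setIC -[in RHS](setUIDK (uncovered k) (past X (cst x0) 0)).
rewrite measureU //; last 3 first.
- exact: measurableI.
- exact: measurableD.
- by apply/seteqP; split=> // w /= [[_ ?] []].
by rewrite [X in (_ = _ + X)%E]p0 adde0.
Qed.

(** * Tail-sum formula for the expected cover time *)

Lemma cover_timeE w :
  cover_time R X w = (\sum_(0 <= k <oo) (\1_(uncovered k) w)%:E)%E.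
Proof.
have u0 k : (0%E <= (\1_(uncovered k) w : R)%:E)%E by rewrite lee_fin.
have [[m0 C0]|NC] := pselect (exists m, covered X w m); last first.
  rewrite /cover_time (_ : [set _ | _ in _] = set0); last first.
    by apply/seteqP; split=> // e [m C]; case: NC; exists m.
  (* Without a covering time the infimum is over the empty set, hence [+oo]; all indicators equal 1,
     so the partial sums exceed every real [A]. *)
  rewrite ereal_inf0; apply/esym/eqyP => A A0.
  have [N AN] : exists N, A <= N%:R.
    by exists (Num.bound A); apply/ltW/archi_boundP/ltW.
  apply: (@le_trans _ _ (\sum_(0 <= k < N) (\1_(uncovered k) w)%:E)%E); last first.
    exact: nneseries_lim_ge.
  rewrite sumEFin lee_fin big_mkord (eq_bigr (fun=> 1)); last first.
    by move=> k _; rewrite indicE mem_set // => C; apply: NC; exists k.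
  by rewrite sumr_const card_ord.
have exC : exists m, `[< covered X w m >] by exists m0; exact/asboolP.
case: (ex_minnP exC) => m /asboolP Cm minm.
have ltm k : uncovered k w <-> (k < m)%N.
  split=> [U|km C]; last by move/asboolP/minm: C; rewrite leqNgt km.
  by rewrite ltnNge; apply/negP => mk; apply: (uncovered_antitone mk U).
transitivity (m%:R%:E : \bar R).
  apply/eqP; rewrite eq_le; apply/andP; split.
    by apply: ereal_inf_lbound; exists m.
  apply: le_ereal_inf_tmp => _ [k /asboolP/minm mk <-].
  by rewrite lee_fin ler_nat.
(* From index [m] on the partial sums are constant, equal to the cover time [m]. *)
apply/esym/lim_near_cst; first exact: ereal_hausdorff.
exists m => // k /= mk; rewrite sumEFin; congr _%:E.
have -> : \sum_(0 <= i < k) (\1_(uncovered i) w : R) = \sum_(0 <= i < k | (i < m)%N) 1.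
  rewrite [RHS]big_mkcond; apply: eq_bigr => j _; case: ifPn => jm.
    by rewrite indicE mem_set //; apply/ltm.
  by rewrite indicE memNset // => /ltm; exact/negP.
by rewrite -(@big_nat_widen _ _ _ 0 m k xpredT) // sumr_const_nat subn0.
Qed.

Lemma expected_cover_timeE :
  expected_cover_time P X = (\sum_(0 <= k <oo) P (uncovered k))%E.
Proof.
rewrite /expected_cover_time.
under eq_integral do rewrite cover_timeE.
rewrite integral_nneseries //; last first.
  move=> k; apply/measurable_EFinP; apply: measurable_indic.
  exact: measurable_uncovered.
apply: eq_eseriesr => k _; rewrite integral_indic ?setIT //.
exact: measurable_uncovered.
Qed.

Lemma sum_uncovered N : (\sum_(0 <= k < N) P (uncovered k))%E =
  (truncated_remaining (cst x0) 0 N)%:E.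
Proof.
rewrite -sumEFin big_mkord; apply: eq_bigr => k _.
rewrite add0n past_start_uncovered fine_probabilityK //.
exact: measurable_uncovered.
Qed.

(** * Potential functions as bounds on the expected cover time *)

Section Potential.
Context (Inv : (nat -> V) -> nat -> Prop) (Psi : (nat -> V) -> nat -> R).
Context (Inv0 : Inv (cst x0) 0).
Context (InvS : forall x m y, Inv x m -> ~ visits_all x m -> pi x m y != 0 ->
  Inv (extend x m y) m.+1).

(** Supermartingale bound, by induction on the horizon [k] and weighted by the probability of the
    past. *)
Lemma truncated_remaining_le :
  (forall x m, Inv x m -> 0 <= Psi x m) ->
  (forall x m, Inv x m -> ~ visits_all x m ->
    1 + \sum_y pi x m y * Psi (extend x m y) m.+1 <= Psi x m) ->
  forall k x m, Inv x m ->
  truncated_remaining x m k <= pr (past X x m) * Psi x m.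
Proof.
move=> Psi0 drift; elim=> [|k IH] x m I.
  by rewrite /truncated_remaining big_ord0 mulr_ge0 ?fine_probability_ge0 ?Psi0.
rewrite truncated_remainingS; case: asboolP => C.
  by rewrite mulr_ge0 ?fine_probability_ge0 ?Psi0.
apply: (@le_trans _ _ (pr (past X x m) *
    (1 + \sum_y pi x m y * Psi (extend x m y) m.+1))); last first.
  by rewrite ler_wpM2l ?fine_probability_ge0 ?drift.
rewrite mulrDr mulr1 lerD2l mulr_sumr; apply: ler_sum => y _.
rewrite mulrA -past_extend_probability.
(* [Inv] may fail after a move of probability 0, but such a move leads to a null past, where both
   sides vanish. *)
have [p0|p0] := eqVneq (pi x m y) 0; last by apply: IH; apply: InvS.
have e0 : pr (past X (extend x m y) m.+1) = 0.
  by rewrite past_extend_probability p0 mulr0.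
by rewrite truncated_remaining_null // e0 mul0r.
Qed.

(** Submartingale counterpart. At the horizon the potential need not be used up; what is left is at
    most [C] on the event that some node is still unvisited, and at most 0 off it. *)
Lemma truncated_remaining_ge C :
  (forall x m, Inv x m -> Psi x m <= C) ->
  (forall x m, Inv x m -> visits_all x m -> Psi x m <= 0) ->
  (forall x m, Inv x m -> ~ visits_all x m ->
    Psi x m <= 1 + \sum_y pi x m y * Psi (extend x m y) m.+1) ->
  forall k x m, Inv x m ->
  pr (past X x m) * Psi x m <= truncated_remaining x m k +
    C * pr (past X x m `&` uncovered (m + k)).
Proof.
move=> PsiC PsiE drift; elim=> [|k IH] x m I.
  rewrite /truncated_remaining big_ord0 addn0 add0r past_uncovered.
  case: asboolP => VA.
    by rewrite measure0 mulr0 mulr_ge0_le0 ?fine_probability_ge0 ?PsiE.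
  by rewrite mulrC ler_wpM2r ?fine_probability_ge0 ?PsiC.
rewrite truncated_remainingS; case: asboolP => VA.
  rewrite add0r (_ : _ `&` _ = set0).
    by rewrite measure0 mulr0 mulr_ge0_le0 ?fine_probability_ge0 ?PsiE.
  apply/seteqP; split=> // w [h U].
  have : (past X x m `&` uncovered m) w.
    by split=> //; apply: uncovered_antitone U; exact: leq_addr.
  by rewrite past_uncovered (asboolT VA).
apply: (@le_trans _ _ (pr (past X x m) *
    (1 + \sum_y pi x m y * Psi (extend x m y) m.+1))).
  by rewrite ler_wpM2l ?fine_probability_ge0 ?drift.
rewrite mulrDr mulr1 -addrA lerD2l past_split; last exact: measurable_uncovered.
rewrite !mulr_sumr -big_split /=; apply: ler_sum => y _.
rewrite mulrA -past_extend_probability.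
have [p0|p0] := eqVneq (pi x m y) 0.
  have e0 : pr (past X (extend x m y) m.+1) = 0.
    by rewrite past_extend_probability p0 mulr0.
  rewrite truncated_remaining_null // e0 mul0r add0r.
  rewrite (_ : pr _ = 0) ?mulr0 //.
  (* The event in the error term is the last summand for horizon [k.+1]; nonnegative summands with
     sum 0 are all 0. *)
  have := truncated_remaining_null k.+1 e0.
  rewrite /truncated_remaining big_ord_recr /= addSnnS => /eqP.
  rewrite paddr_eq0 ?fine_probability_ge0 //; last first.
    by apply: sumr_ge0 => j _; exact: fine_probability_ge0.
  by move=> /andP[_ /eqP].
by rewrite -addSnnS; apply: IH; apply: InvS.
Qed.

Lemma expected_cover_time_le :
  (forall x m, Inv x m -> 0 <= Psi x m) ->
  (forall x m, Inv x m -> ~ visits_all x m ->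
    1 + \sum_y pi x m y * Psi (extend x m y) m.+1 <= Psi x m) ->
  (expected_cover_time P X <= (Psi (cst x0) 0)%:E)%E.
Proof.
move=> Psi0 drift; rewrite expected_cover_timeE; apply: lime_le.
  by apply: is_cvg_nneseries.
apply: nearW => N; rewrite sum_uncovered lee_fin.
apply: le_trans (truncated_remaining_le Psi0 drift N Inv0) _.
by rewrite past_start mul1r.
Qed.

(** The a priori bound [M] makes the expectation finite, which is what lets the error term of
    [truncated_remaining_ge] tend to 0. *)
Lemma expected_cover_time_ge (C M : R) :
  0 <= C -> (expected_cover_time P X <= M%:E)%E ->
  (forall x m, Inv x m -> Psi x m <= C) ->
  (forall x m, Inv x m -> visits_all x m -> Psi x m <= 0) ->
  (forall x m, Inv x m -> ~ visits_all x m ->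
    Psi x m <= 1 + \sum_y pi x m y * Psi (extend x m y) m.+1) ->
  ((Psi (cst x0) 0)%:E <= expected_cover_time P X)%E.
Proof.
move=> C0 EM PsiC PsiE drift.
have lb N : ((truncated_remaining (cst x0) 0 N)%:E <= expected_cover_time P X)%E.
  by rewrite -sum_uncovered expected_cover_timeE; exact: nneseries_lim_ge.
have Efin : expected_cover_time P X \is a fin_num.
  rewrite fin_real // (lt_le_trans _ (lb 0%N)) ?ltNyr //=.
  by rewrite (le_lt_trans EM) ?ltry.
move: lb; rewrite -(fineK Efin); set a := fine _ => lb.
rewrite lee_fin; apply/ler_addgt0Pr => e e0.
(* Markov: P(T_C > k) <= a / k, so the error term C P(T_C > k) tends to 0. *)
pose k := Num.bound (C * a / e).
(* Each of the first [k] tail probabilities is at least [pr (uncovered k)], and together they sum to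
   at most the expectation. *)
have kpr : k%:R * pr (uncovered k) <= a.
  rewrite -lee_fin; apply: le_trans (lb k); rewrite lee_fin /truncated_remaining.
  rewrite -[k in k%:R]card_ord mulr_natl -sumr_const; apply: ler_sum => j _.
  rewrite add0n past_start_uncovered.
  apply: le_fine_probability; try exact: measurable_uncovered.
  by apply: uncovered_antitone; exact: ltnW.
have pk0 := fine_probability_ge0 (uncovered k).
have a0 : 0 <= a by apply: le_trans kpr; exact: mulr_ge0.
have := truncated_remaining_ge PsiC PsiE drift k Inv0.
rewrite past_start mul1r add0n past_start_uncovered => /le_trans; apply.
apply: lerD; first by have := lb k; rewrite lee_fin.
have kb : C * a / e < k%:R by apply: archi_boundP; rewrite divr_ge0 ?mulr_ge0 // ltW.
have k0 : 0 < k%:R :> R.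
  by apply: le_lt_trans kb; rewrite divr_ge0 ?mulr_ge0 // ltW.
rewrite -(ler_pM2l k0) mulrCA; apply: (@le_trans _ _ (C * a)).
  exact: ler_wpM2l.
by apply/ltW; rewrite -ltr_pdivrMr.
Qed.

End Potential.

End CoverTime.

(** * One-step identities for crossings, uniform averages and [Smin] *)

Lemma crossings_extend (V : finType) (x : nat -> V) m y i j :
  crossings (extend x m y) m.+1 i j =
    (crossings x m i j + ((x m == i) && (y == j)))%N.
Proof.
have crossingsE z k :
    crossings z k i j = (\sum_(t < k) ((z t == i) && (z t.+1 == j)))%N.
  rewrite /crossings -sum1_card big_mkcond; apply: eq_bigr => t _.
  by rewrite inE; case: (_ && _).
rewrite !crossingsE big_ord_recr /= /extend leqnn ltnn; congr (_ + _)%N.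
by apply: eq_bigr => t _; rewrite ltn_ord ltnW.
Qed.

Lemma sum_uniform_on (R : realType) (V : finType) (S : {set V}) (f : V -> R) :
  \sum_y uniform_on R S y * f y = (\sum_(y in S) f y) / #|S|%:R.
Proof.
rewrite [in RHS]big_mkcond mulr_suml; apply: eq_bigr => y _.
by rewrite /uniform_on; case: ifP => _; rewrite ?mul0r // mulrC.
Qed.

Lemma sum_uniform_on1 (R : realType) (V : finType) (a : V) (f : V -> R) :
  \sum_y uniform_on R [set a]%SET y * f y = f a.
Proof. by rewrite sum_uniform_on big_set1 cards1 divr1. Qed.

Lemma sum_uniform_on2 (R : realType) (V : finType) (a b : V) (f : V -> R) :
  a != b -> \sum_y uniform_on R [set a; b]%SET y * f y = (f a + f b) / 2.
Proof. by move=> ab; rewrite sum_uniform_on big_setU1 ?inE // big_set1 cards2 ab. Qed.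

Lemma uniform_on_neq0 (R : realType) (V : finType) (S : {set V}) y :
  uniform_on R S y != 0 -> y \in S.
Proof. by rewrite /uniform_on; case: ifP => //; rewrite eqxx. Qed.

Lemma Smin_set1 (V : finType) (e : rel V) x m i a :
  neighbours e i = [set a]%SET -> Smin e x m i = [set a]%SET.
Proof.
move=> E; apply/setP => j; rewrite /Smin E !inE; case: eqP => //= ->.
by apply/forall_inP => k; rewrite inE => /eqP ->.
Qed.

Lemma Smin_set2 (V : finType) (e : rel V) x m i a b :
  neighbours e i = [set a; b]%SET ->
  Smin e x m i =
    if (crossings x m i a < crossings x m i b)%N then [set a]%SET
    else if (crossings x m i b < crossings x m i a)%N then [set b]%SET
    else [set a; b]%SET.
Proof.
move=> E; have minE j : [forall k in neighbours e i,
    (crossings x m i j <= crossings x m i k)%N] =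
    (crossings x m i j <= crossings x m i a)%N &&
    (crossings x m i j <= crossings x m i b)%N.
  rewrite E; apply/forall_inP/andP => [h|[ha hb] k].
    by split; apply: h; rewrite !inE eqxx ?orbT.
  by rewrite !inE => /orP[] /eqP ->.
apply/setP => j; rewrite /Smin finset.in_set minE E !inE.
case: ltngtP => ab; rewrite !inE.
- have [->|_] := eqVneq j a; first by rewrite leqnn ltnW.
  by have [->|] := eqVneq j b; rewrite //= leqNgt ab.
- have [->|_] := eqVneq j b; first by rewrite orbT leqnn ltnW.
  by have [->|] := eqVneq j a; rewrite //= leqnn leqNgt ab.
- by have [->|_] := eqVneq j a; [|have [->|_] := eqVneq j b]; rewrite //= ab leqnn.
Qed.

(** * The path graph *)

Section Path.
Context (R : realType) (n : nat) (hn : (2 <= n)%N).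

Local Notation V := 'I_n.+1.
Local Notation G := (path_graph n).

Lemma neighbours_path0 (i : V) : i = 0%N :> nat ->
  neighbours G i = [set inord 1]%SET.
Proof.
move=> i0; apply/setP => j; rewrite !inE /path_graph -val_eqE /= inordK; lia.
Qed.

Lemma neighbours_path_inner (i : V) : (0 < i < n)%N ->
  neighbours G i = [set inord i.+1; inord i.-1]%SET.
Proof.
move=> hi; apply/setP => j; rewrite !inE /path_graph -!val_eqE /= !inordK; lia.
Qed.

(** Moves between neighbours, started at 0, cannot skip a node; this invariant is why covering the
    path amounts to hitting [n]. *)
Definition downset_visited (x : nat -> V) m :=
  forall v : V, (v <= x m)%N -> exists2 t, (t <= m)%N & x t = v.

Lemma downset_visited_extend x m y : downset_visited x m ->
  y \in neighbours G (x m) -> downset_visited (extend x m y) m.+1.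
Proof.
move=> D; rewrite inE /path_graph => xy v; rewrite {1}/extend ltnn => vy.
have [->|vny] := eqVneq v y.
  by exists m.+1 => //; rewrite /extend ltnn.
have [|t tm xt] := D v; first by move: vny; rewrite -val_eqE /=; lia.
by exists t; [exact: leqW|rewrite /extend tm].
Qed.

Lemma unvisited_lt x m : downset_visited x m -> ~ visits_all x m -> (x m < n)%N.
Proof.
move=> D NV; rewrite ltnNge; apply/negP => nx; apply: NV => v; apply: D.
by apply: leq_trans nx; rewrite -ltnS.
Qed.

(** * The random walk *)

Section RandomWalk.
Context (d : measure_display) (T : measurableType d) (P : probability T R).
Context (X : nat -> T -> V) (XP : follows P (pi_rw R G) ord0 X).

(** The second clause forces the walk to sit at [n] at the first covering time, so that the
    potential vanishes there, as the lower bound requires. *)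
Definition rw_inv (x : nat -> V) m :=
  downset_visited x m /\ forall t, (t < m)%N -> x t <> ord_max.

Definition rw_potential (x : nat -> V) (m : nat) : R := n%:R ^+ 2 - (x m)%:R ^+ 2.

Lemma rw_inv0 : rw_inv (cst ord0) 0.
Proof. by split=> // v; rewrite leqn0 => /eqP v0; exists 0%N => //; apply: val_inj. Qed.

Lemma rw_invS x m y : rw_inv x m -> ~ visits_all x m ->
  pi_rw R G x m y != 0 -> rw_inv (extend x m y) m.+1.
Proof.
move=> [D N] NV /uniform_on_neq0 yS; split; first exact: downset_visited_extend.
move=> t; rewrite ltnS /extend => tm; rewrite tm.
have := unvisited_lt D NV; move: tm; rewrite leq_eqVlt => /orP[/eqP ->|/N //].
by move=> lt E; move: lt; rewrite E ltnn.
Qed.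

(** The mean of (p+1)^2 and (p-1)^2 is p^2 + 1, and the forced move from 0 to 1 also raises p^2 by
    1. *)
Lemma rw_drift x m : rw_inv x m -> ~ visits_all x m ->
  1 + \sum_y pi_rw R G x m y * rw_potential (extend x m y) m.+1 = rw_potential x m.
Proof.
move=> [D _] /(unvisited_lt D) xn; rewrite /pi_rw /rw_potential /extend ltnn.
have [x0|x0] := posnP (x m).
  rewrite neighbours_path0 // sum_uniform_on1 inordK ?ltnS; last lia.
  by rewrite x0; ring.
rewrite neighbours_path_inner ?x0 // sum_uniform_on2; last first.
  by rewrite -val_eqE /= !inordK; lia.
rewrite !inordK; [|lia..].
(* Writing the node as [k.+1] removes the truncated predecessor before passing to the field. *)
by case: (x m : nat) x0 => // k _ /=; rewrite -!natr1; field.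
Qed.

Theorem rw_expected_cover_time : expected_cover_time P X = (n%:R ^+ 2)%:E.
Proof.
have E0 : rw_potential (cst ord0) 0 = n%:R ^+ 2 by rewrite /rw_potential /=; ring.
have pot_ge0 x m : 0 <= rw_potential x m.
  rewrite subr_ge0 ler_sqr ?nnegrE // ler_nat -ltnS; exact: ltn_ord.
(* The upper bound comes first, since it supplies the finiteness needed for the lower bound. *)
have le : (expected_cover_time P X <= (n%:R ^+ 2)%:E)%E.
  rewrite -E0; apply: (expected_cover_time_le XP rw_inv0 rw_invS) => // x m I NV.
  by rewrite rw_drift.
apply/eqP; rewrite eq_le le -E0 /=.
apply: (expected_cover_time_ge (C := n%:R ^+ 2) XP rw_inv0 rw_invS _ le).
- exact: exprn_ge0.
- by move=> x m _; rewrite gerBl exprn_ge0.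
- move=> x m [_ N] VA; have [t] := VA ord_max.
  rewrite leq_eqVlt => /orP[/eqP ->|/N //] E.
  by rewrite /rw_potential E subrr.
- by move=> x m I NV; rewrite rw_drift.
Qed.

End RandomWalk.

(** * Negative feedback *)

Section NegativeFeedback.
Context (d : measure_display) (T : measurableType d) (P : probability T R).
Context (X : nat -> T -> V) (XP : follows P (pi_neg R G) ord0 X).

(** Meaningful for [0 < i < n] only. At [i = 0] the predecessor is 0 itself; that value is discarded
    below by the weight [2 * i] or by a guard [0 < x m]. *)
Definition imbalance (x : nat -> V) (m i : nat) : int :=
  (crossings x m (inord i) (inord i.+1))%:Z - (crossings x m (inord i) (inord i.-1))%:Z.

Lemma imbalance0 x i : imbalance x 0 i = 0.
Proof.
have c0 (A : {set 'I_0}) : #|A| = 0%N by apply: eq_card0 => -[].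
by rewrite /imbalance /crossings !c0.
Qed.

Definition direction (i j : nat) : int := if (i < j)%N then 1 else -1.

Lemma imbalance_extend x m y i : y \in neighbours G (x m) -> (0 < i < n)%N ->
  imbalance (extend x m y) m.+1 i =
    imbalance x m i + (if x m == i :> nat then direction i y else 0).
Proof.
move=> yS hi; rewrite /imbalance !crossings_extend -!val_eqE /= !inordK; [|lia..].
move: yS; rewrite inE /path_graph /direction.
by have [<-|_] := eqVneq (x m : nat) i; [case: (ltnP (x m) y)|]; lia.
Qed.

(** Minimising the crossings means moving against the sign of the imbalance. Node 0, whose only
    neighbour is on the right, shares the branch of negative imbalance. *)
Lemma Smin_path (x : nat -> V) m : (x m < n)%N ->
  Smin G x m (x m) =
    if (0 < x m)%N && (imbalance x m (x m) == 0)
    then [set inord (x m).+1; inord (x m).-1]%SET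
    else if (0 < x m)%N && (0 < imbalance x m (x m))
    then [set inord (x m).-1]%SET else [set inord (x m).+1]%SET.
Proof.
move=> xn; have [x0|x0] := posnP (x m).
  by rewrite (Smin_set1 _ _ (neighbours_path0 x0)) x0.
have hx : (0 < x m < n)%N by rewrite x0.
rewrite (Smin_set2 _ _ (neighbours_path_inner hx)) /imbalance inord_val /=.
set a := crossings _ _ _ _; set b := crossings _ _ _ _.
have -> : (a%:Z - b%:Z == 0) = (a == b) by lia.
have -> : (0 < a%:Z - b%:Z) = (b < a)%N by lia.
by case: ltngtP.
Qed.

(* The last move from a node left of the current one went right, and the last
   move from a visited node right of the current one went left. *)
Definition neg_inv (x : nat -> V) m :=
  downset_visited x m /\
  forall i, (0 < i < n)%N ->
    - (x m <= i)%N%:Z <= imbalance x m i <= (i <= x m)%N%:Z /\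
    (i = n.-1 -> (x m < n)%N -> imbalance x m i <= 0).

(** For p < n the term of index n-1 is merged with its correction: 2(n-1)s - (n-1)(1+s) = (n-1)s - n
    + 1, where s is the imbalance of n-1. At p = n that term cancels against its own final value, so
    only the sum up to n-2 remains. *)
Definition neg_potential (x : nat -> V) (m : nat) : R :=
  \sum_(i < n.-1) (2 * i)%:R * (imbalance x m i)%:~R +
  (if (x m < n)%N then n%:R ^+ 2 - n%:R + 1 - (x m)%:R ^+ 2
      + n.-1%:R * (imbalance x m n.-1)%:~R else 0).

Lemma neg_inv0 : neg_inv (cst ord0) 0.
Proof.
split=> [v|i hi].
  by rewrite leqn0 => /eqP v0; exists 0%N => //; apply: val_inj.
by rewrite imbalance0; split=> //=; case: leqP.
Qed.

Lemma neg_invS x m y : neg_inv x m -> ~ visits_all x m ->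
  pi_neg R G x m y != 0 -> neg_inv (extend x m y) m.+1.
Proof.
move=> [D B] /(unvisited_lt D) xn /uniform_on_neq0 yS.
have yN : y \in neighbours G (x m) by move: yS; rewrite /Smin finset.in_set => /andP[].
split=> [|i hi]; first exact: downset_visited_extend.
rewrite imbalance_extend // /extend ltnn; have [] := B i hi.
move: (yN) yS; rewrite Smin_path // inE /path_graph /direction.
(* A node other than the current one keeps its imbalance, and a move of length one never tightens
   its bounds. *)
have [ei|xi] := eqVneq (x m : nat) i; last by move=> + _; lia.
subst i.
(* At the current node, a right move needs a nonpositive imbalance and a left move a nonnegative
   one. From n-1 a right move reaches n, so no surplus of right moves is seen there while the walk
   is left of n. *)
have balance_step (s : int) (p y' : nat) : (0 < p < n)%N ->
    -1 <= s <= 1 -> (p = n.-1 -> s <= 0) ->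
    (y' = p.+1 /\ s <= 0) \/ (y' = p.-1 /\ 0 <= s) ->
    - (y' <= p)%N%:Z <= s + (if (p < y')%N then 1 else -1) <= (p <= y')%N%:Z /\
    (p = n.-1 -> (y' < n)%N -> s + (if (p < y')%N then 1 else -1) <= 0).
  move=> hp hs hn1 [[-> h]|[-> h]].
    by rewrite ltnSn leqnSn ltnn /=; split; lia.
  have -> : (p < p.-1)%N = false by lia.
  have -> : (p <= p.-1)%N = false by lia.
  by rewrite leq_pred; split; lia.
move=> _ yS; rewrite leqnn => hs hn1; apply: balance_step; [lia|exact: hs| |].
  by move=> /hn1; apply.
move: yS; case: ifPn => [|s0]; last case: ifPn => [|s1].
- by move=> /andP[_ /eqP ->]; rewrite !inE -!val_eqE /= !inordK; lia.
- by move=> /andP[_ s1]; rewrite !inE -!val_eqE /= inordK; lia.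
- by rewrite !inE -!val_eqE /= inordK; lia.
Qed.

Lemma neg_potential_extend x m y : y \in neighbours G (x m) ->
  neg_potential (extend x m y) m.+1 =
  \sum_(i < n.-1) (2 * i)%:R * (imbalance x m i)%:~R +
  (if (x m < n.-1)%N then (2 * x m)%:R * (direction (x m) y)%:~R else 0) +
  (if (y < n)%N then n%:R ^+ 2 - n%:R + 1 - y%:R ^+ 2
      + n.-1%:R * (imbalance x m n.-1 +
          (if x m == n.-1 :> nat then direction n.-1 y else 0))%:~R else 0).
Proof.
move=> yN; rewrite /neg_potential imbalance_extend //; last lia.
rewrite {2 3}/extend ltnn; congr (_ + _).
transitivity (\sum_(i < n.-1) ((2 * i)%:R * (imbalance x m i)%:~R +
   (if x m == i :> nat then (2 * i)%:R * (direction i y)%:~R else 0)) : R).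
  apply: eq_bigr => i _; have [->|i0] := posnP i.
    by rewrite !mul0r; case: ifP => _; rewrite addr0.
  rewrite imbalance_extend //; last by have := ltn_ord i; lia.
  by rewrite intrD mulrDr; case: ifP => //; rewrite mulr0.
rewrite big_split /=; congr (_ + _); case: ltnP => xn.
  rewrite (bigD1 (Ordinal xn)) //= eqxx big1 ?addr0 // => i.
  by rewrite -val_eqE /= eq_sym => /negbTE ->.
by rewrite big1 // => i _; case: eqP => // E; have := ltn_ord i; lia.
Qed.

(** For a move from p to p+1 or p-1, -p^2 changes by -2p-1 or 2p-1 while 2p s_p changes by 2p or
    -2p; the total is -1 in both cases. *)
Lemma neg_potential_inner (x : nat -> V) m y :
  (x m < n.-1)%N -> y \in neighbours G (x m) ->
  neg_potential (extend x m y) m.+1 = neg_potential x m - 1.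
Proof.
move=> xn yN; rewrite neg_potential_extend // /neg_potential xn .
have -> : (x m < n)%N by lia.
have -> : (y < n)%N by move: yN; rewrite inE /path_graph; lia.
rewrite ltn_eqF // addr0 natrM; move: yN; rewrite inE /path_graph /direction.
case/orP=> /eqP E; [rewrite -E ltnSn|rewrite -E ltnNge leqnSn] => /=.
  by rewrite -natr1; ring.
by rewrite -natr1; ring.
Qed.

Lemma neg_drift x m : neg_inv x m -> ~ visits_all x m ->
  1 + \sum_y pi_neg R G x m y * neg_potential (extend x m y) m.+1 =
  neg_potential x m.
Proof.
move=> [D B] /(unvisited_lt D) xn; rewrite /pi_neg.
have [xn1|xn1] := ltnP (x m) n.-1.
  rewrite sum_uniform_on (eq_bigr (fun=> neg_potential x m - 1)); last first.
    move=> y; rewrite /Smin finset.in_set => /andP[yN _].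
    exact: neg_potential_inner.
  rewrite sumr_const -[X in X / _]mulr_natr mulfK ?subrKC //.
  rewrite pnatr_eq0 Smin_path //.
  by case: ifP => _; [rewrite cards2|case: ifP => _; rewrite cards1].
have xE : x m = n.-1 :> nat by lia.
have p1 : n.-1%:R = n%:R - 1 :> R by rewrite -subn1 natrB //; lia.
have p2 : n.-2%:R = n%:R - 2 :> R by rewrite -subn2 natrB.
have rN : inord (x m).+1 \in neighbours G (x m).
  by rewrite inE /path_graph inordK ?eqxx //; lia.
have lN : inord (x m).-1 \in neighbours G (x m).
  by rewrite inE /path_graph inordK; lia.
have [|/andP[lb _] /(_ erefl xn) ub] := B n.-1; first lia.
have {lb} lb : -1 <= imbalance x m n.-1 by move: lb; rewrite xE leqnn.
rewrite Smin_path // xE [(0 < _)%N](_ : _ = true) /=; last lia.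
(* The invariant leaves imbalance 0 or -1 at n-1. Let S be the sum over i < n-1. For 0 the potential
   is S + n, and the equally likely next values are S at n and S + 2n - 2 at n-2, of mean S + n -
   1. *)
rewrite ltNge ub /=; case: eqVneq => [s0|s0].
  rewrite sum_uniform_on2; last by rewrite -val_eqE /= !inordK; lia.
  rewrite -xE !neg_potential_extend // !inordK; [|lia..].
  rewrite /neg_potential /direction xE ltnn eqxx s0 prednK; last lia.
  have -> : (n.-2 < n)%N by lia.
  have -> : (n <= n.-2)%N = false by lia.
  rewrite ltnn leqnn.
  by rewrite addr0 add0r p1 p2; field.
(* For -1 the move to n is forced and takes the potential from S + 1 to S. *)
have {s0} s1 : imbalance x m n.-1 = -1 by lia.
rewrite sum_uniform_on1 -xE neg_potential_extend // inordK; last lia.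
rewrite /neg_potential xE ltnn eqxx s1 prednK; last lia.
by rewrite ltnn leqnn p1; ring.
Qed.

(** The sum telescopes, since 2i = (i+1)i - i(i-1). *)
Lemma sum_doubles_from (p N : nat) : (p <= N)%N ->
  \sum_(i < N) (2 * i)%:R * (p <= i)%:R = N%:R * (N%:R - 1) - p%:R * (p%:R - 1) :> R.
Proof.
elim: N => [|N IH]; first by rewrite leqn0 big_ord0 => /eqP ->; ring.
rewrite leq_eqVlt => /orP[/eqP ->|pN].
  by rewrite subrr big1 // => i _; rewrite leqNgt ltn_ord mulr0.
rewrite ltnS in pN; rewrite big_ord_recr /= IH // pN mulr1 natrM -[N.+1]addn1 natrD.
by ring.
Qed.

(** For p < n the worst case allowed by the bounds has imbalance -1 at every i >= p and 0 at every i
    < p; it still leaves n - p > 0. At p = n all imbalances are nonnegative. *)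
Lemma neg_potential_ge0 x m : neg_inv x m -> 0 <= neg_potential x m.
Proof.
move=> [_ B]; rewrite /neg_potential.
have lb : - (\sum_(i < n.-1) (2 * i)%:R * (x m <= i)%:R) <=
    \sum_(i < n.-1) (2 * i)%:R * (imbalance x m i)%:~R :> R.
  rewrite -sumrN; apply: ler_sum => i _; have [->|i0] := posnP i.
    by rewrite !mul0r oppr0.
  rewrite -mulrN ler_wpM2l //.
  have [|/andP[+ _] _] := B i; first by have := ltn_ord i; lia.
  by rewrite -(ler_int R) rmorphN.
case: ltnP => xn; last first.
  rewrite addr0; apply: le_trans lb; rewrite oppr_ge0 big1 // => i _.
  by rewrite leqNgt (_ : (i < x m)%N) ?mulr0 //; have := ltn_ord i; lia.
move: lb; rewrite sum_doubles_from; last lia.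
have [|/andP[+ _] _] := B n.-1; first lia.
rewrite -(ler_int R) rmorphN /= (_ : (x m <= n.-1)%N); last lia.
have -> : n.-1%:R = n%:R - 1 :> R by rewrite -subn1 natrB //; lia.
set s := (imbalance x m n.-1)%:~R; set W := \sum_(_ < _) _.
have : (x m)%:R + 1 <= n%:R :> R by rewrite natr1 ler_nat.
have : 2 <= n%:R :> R by rewrite ler_nat.
set p := (x m)%:R; set q : R := n%:R => h1 h2 h3 h4.
have : (q - 1) * -1 <= (q - 1) * s by rewrite ler_wpM2l //; lra.
nra.
Qed.

Theorem neg_expected_cover_time_lt : (expected_cover_time P X < (n%:R ^+ 2)%:E)%E.
Proof.
apply: le_lt_trans (expected_cover_time_le XP neg_inv0 neg_invS neg_potential_ge0 _) _.
  by move=> x m I NV; rewrite neg_drift.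
(* The initial potential is n^2 - n + 1, which is below n^2 because n >= 2. *)
rewrite lte_fin /neg_potential imbalance0 big1 ?add0r => [|i _]; last first.
  by rewrite imbalance0 mulr0.
rewrite (_ : (_ < n)%N) /=; last lia.
have : 2 <= n%:R :> R by rewrite ler_nat.
by rewrite mulr0; lra.
Qed.

End NegativeFeedback.

End Path.

Theorem theorem4 (R : realType) (n : nat) (hn : (2 <= n)%N) :
  (forall (d : measure_display) (T : measurableType d) (P : probability T R)
      (X : nat -> T -> 'I_n.+1),
    follows P (pi_neg R (path_graph n)) ord0 X ->
    (expected_cover_time P X < (n%:R ^+ 2)%:E)%E) /\
  (forall (d : measure_display) (T : measurableType d) (P : probability T R)
      (X : nat -> T -> 'I_n.+1),
    follows P (pi_rw R (path_graph n)) ord0 X ->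
    expected_cover_time P X = (n%:R ^+ 2)%:E).
Proof.
split=> d T P X XP.
  exact: neg_expected_cover_time_lt XP.
exact: rw_expected_cover_time XP.
Qed.
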